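(* Let $M$ be a rank-$4$ OTE matroid with ground set $T$, and let $M'$ be an extension of $M$ with ground set $E'$ and rank function $\operatorname{rk}'$. Let $X,Y\subseteq E'$ be such that $X\cap Y$ is a flat of $M'$ and $X\cap T$, $Y\cap T$ are disjoint coplanar lines of $M$. If $T\not\subseteq\operatorname{cl}_{M'}(X\cup Y)$, then $(X,Y)$ is not a modular pair in $M'$, i.e. $\operatorname{rk}'(X)+\operatorname{rk}'(Y)\neq\operatorname{rk}'(X\cup Y)+\operatorname{rk}'(X\cap Y)$.
   Context: Lines are flats of rank $2$; two lines are coplanar if their union has rank $3$. A pair $(A,B)$ of flats of $M$ is modular if $\operatorname{rk}(A)+\operatorname{rk}(B)=\operatorname{rk}(A\cup B)+\operatorname{rk}(A\cap B)$. A modular cut of $M$ is a set of flats closed under flat supersets and under intersections of members forming a modular pair; it is principal if it equals $\{G\text{ flat}: G\supseteq F\}$ for some flat $F$; $M$ is OTE if every nonempty modular cut is principal. An extension of $M$ is a matroid on a superset of $T$ whose restriction to $T$ is $M$. *)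

(* Defs.v *)
From mathcomp Require Import all_boot all_classical.

Set Implicit Arguments.
Unset Strict Implicit.
Unset Printing Implicit Defensive.

Local Open Scope classical_set_scope.
Local Open Scope card_scope.
Local Open Scope nat_scope.

(* Matroids of finite rank on an arbitrary ground set inside a type U. The
   values of rk outside the powerset of the ground set are irrelevant: every
   notion below evaluates rk on subsets of the ground set only.
   rk_finitary holds trivially (B := A) when the ground set is finite, so on
   finite ground sets these are the usual rank axioms; on infinite ones it
   excludes e.g. the function that is 0 on finite sets and 1 on infinite sets. *)
Record matroid (U : Type) := Matroid {
  ground : set U ;
  rk : set U -> nat ;
  rk_card : forall (A : set U) (n : nat),
    A `<=` ground -> A #<= `I_n -> rk A <= n ;
  rk_mono : forall A B : set U,
    A `<=` B -> B `<=` ground -> rk A <= rk B ;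
  rk_submod : forall A B : set U,
    A `<=` ground -> B `<=` ground ->
    rk (A `|` B) + rk (A `&` B) <= rk A + rk B ;
  rk_finitary : forall A : set U,
    A `<=` ground ->
    exists B : set U, [/\ B `<=` A, finite_set B & rk B = rk A]
}.

Section MatroidNotions.
Variables (U : Type) (M : matroid U).
Implicit Types (A B F G L : set U) (C : set (set U)).

Definition cl A : set U :=
  [set x | ground M x /\ rk M (A `|` [set x]) = rk M A].

Definition flat F : Prop := F `<=` ground M /\ cl F = F.

Definition line L : Prop := flat L /\ rk M L = 2.

Definition coplanar A B : Prop := rk M (A `|` B) = 3.

(* Also used for pairs of sets that need not be flats. *)
Definition modular_pair A B : Prop :=
  rk M A + rk M B = rk M (A `|` B) + rk M (A `&` B).

Definition modular_cut C : Prop :=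
  [/\ forall F, C F -> flat F,
      forall F G, C F -> flat G -> F `<=` G -> C G
    & forall F G, C F -> C G -> modular_pair F G -> C (F `&` G)].

Definition principal C : Prop :=
  exists F, flat F /\ C = [set G | flat G /\ F `<=` G].

Definition OTE : Prop :=
  forall C, modular_cut C -> C !=set0 -> principal C.

Definition extension (M' : matroid U) : Prop :=
  ground M `<=` ground M' /\
  forall A, A `<=` ground M -> rk M' A = rk M A.

End MatroidNotions.

(* Main.v *)
(** Write [Z] for [X `&` Y], [T] for the ground set of [M], [r] for the rank in
    [M'], and put lc(F) = r(F) + r(Z) - r(F u Z), the local connectivity of [F]
    and [Z]. If [(X, Y)] were modular, the lines [X `&` T] and [Y `&` T] would
    be skew in M'/Z; as they span only a plane, each of them has lc at least 1.
    A point of [T] outside the closure of [X `|` Y] gives lc(T) <= 1. Hence the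
    flats [F] of [M] with lc(F) >= 1 form a modular cut containing both lines.
    It is principal, generated by a flat inside their empty intersection,
    although lc of the empty set is 0. *)

Require Import Defs.
From mathcomp Require Import all_boot all_classical.
From mathcomp Require Import zify.

Local Open Scope classical_set_scope.
Local Open Scope nat_scope.

Section Rank.
Variables (U : Type) (M : matroid U).
Implicit Types (A B C F G : set U).

Lemma rk0 : rk M set0 = 0.
Proof.
apply/eqP; rewrite -leqn0; apply: rk_card; first exact: sub0set.
exact: card_ge0.
Qed.

(** Submodularity for [A]|[C] and [B]: their union is [B]|[C] and their intersection contains
    [A]. *)
Lemma rk_setU_diminish A B C :
  A `<=` B -> B `<=` ground M -> C `<=` ground M ->
  rk M (B `|` C) + rk M A <= rk M (A `|` C) + rk M B.
Proof.
move=> AB BE CE.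
have ACE : A `|` C `<=` ground M by rewrite subUset; split=> // x /AB /BE.
have := rk_submod ACE BE.
have -> : (A `|` C) `|` B = B `|` C.
  by rewrite setUAC (setUidr AB).
have : rk M A <= rk M ((A `|` C) `&` B).
  by apply: rk_mono => [x Ax|x [_ /BE]//]; split; [left|exact: AB].
lia.
Qed.

Lemma cl_mono A B : A `<=` B -> B `<=` ground M -> cl M A `<=` cl M B.
Proof.
move=> AB BE x [Ex rAx]; split=> //.
have xE : [set x] `<=` ground M by move=> _ ->.
have := rk_setU_diminish _ _ _ AB BE xE.
have : rk M B <= rk M (B `|` [set x]).
  by apply: rk_mono => [y|]; [left|rewrite subUset].
lia.
Qed.

Lemma flat_setI F G : flat M F -> flat M G -> flat M (F `&` G).
Proof.
move=> [FE clF] [GE clG]; have FGE : F `&` G `<=` ground M by move=> x [/FE].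
split=> //; apply/seteqP; split=> [x clx|x FGx].
  split; first by rewrite -clF; apply: cl_mono clx => //; exact: subIsetl.
  by rewrite -clG; apply: cl_mono clx => //; exact: subIsetr.
by split; [exact: FGE|rewrite setUidl// => _ ->].
Qed.

Lemma rk_lt_flatU F A :
  flat M F -> A `<=` ground M -> ~ (A `<=` F) -> rk M F < rk M (A `|` F).
Proof.
move=> [FE clF] AE nAF; rewrite ltnNge; apply/negP => rAF; apply: nAF => x Ax.
rewrite -clF; split; first exact: AE.
have AFE : A `|` F `<=` ground M by rewrite subUset.
have xAF : F `|` [set x] `<=` A `|` F by move=> y [|->]; [right|left].
have := rk_mono xAF AFE.
have : rk M F <= rk M (F `|` [set x]).
  by apply: rk_mono => [y|]; [left|exact: subset_trans xAF AFE].
lia.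
Qed.

End Rank.

Section Skew.
Variables (U : Type) (M : matroid U).
Implicit Types (A B X Y : set U).

(** Skewness in M'/Z, with Z = [X]&[Y], passes to subsets: grow [A]|[Z] to [X] in the presence of
    [B], then [B]|[Z] to [Y] in the presence of [X]. Neither step increases the gain in rank from
    the other set. *)
Lemma modular_pair_restrict X Y A B :
  X `<=` ground M -> Y `<=` ground M -> A `<=` X -> B `<=` Y ->
  modular_pair M X Y ->
  rk M (A `|` X `&` Y) + rk M (B `|` X `&` Y)
    <= rk M (A `|` B `|` X `&` Y) + rk M (X `&` Y).
Proof.
move=> XE YE AX BY; rewrite /modular_pair.
set Z := X `&` Y => modXY.
have ZX : Z `<=` X by exact: subIsetl.
have ZY : Z `<=` Y by exact: subIsetr.
have AZX : A `|` Z `<=` X by rewrite subUset.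
have BZY : B `|` Z `<=` Y by rewrite subUset.
have := rk_setU_diminish _ _ _ _ _ AZX XE (subset_trans BY YE).
have := rk_setU_diminish _ _ _ _ _ BZY YE XE.
rewrite (setUC Y X) (setUAC A Z B) -setUA (setUidr ZX) (setUC B X).
lia.
Qed.

End Skew.

Section ConnectivityCut.
Variables (U : Type) (M M' : matroid U) (Z : set U).
Hypotheses (extM : extension M M') (ZE : Z `<=` ground M').
(* lc(T) <= 1 *)
Hypothesis lcT :
  rk M (ground M) + rk M' Z <= (rk M' (ground M `|` Z)).+1.

(* lc(F) >= 1 *)
Definition connectivity_cut : set (set U) :=
  [set F | flat M F /\ rk M' (F `|` Z) < rk M F + rk M' Z].

(** Upward closure holds because lc is monotone. For a modular pair, submodularity of r(- u Z) gives
    lc(F) + lc(G) <= lc(F u G) + lc(F n G); the left side is at least 2 and lc(F u G) <= lc(T) <= 1,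
    which leaves lc(F n G) >= 1. *)
Lemma connectivity_cut_modular : modular_cut M connectivity_cut.
Proof.
have [TE rkE] := extM.
split=> [F [] // | F G [[FT _] lcF] fG FG | F G [fF lcF] [fG lcG] modFG].
  have [GT _] := fG; split=> //.
  have := rk_setU_diminish _ _ _ _ _ FG (subset_trans GT TE) ZE.
  rewrite (rkE _ FT) (rkE _ GT); lia.
have [[FT _] [GT _]] := (fF, fG).
split; first exact: flat_setI.
have FGT : F `|` G `<=` ground M by rewrite subUset.
have FZE : F `|` Z `<=` ground M'.
  by rewrite subUset; split=> //; exact: subset_trans TE.
have GZE : G `|` Z `<=` ground M'.
  by rewrite subUset; split=> //; exact: subset_trans TE.
have := rk_submod FZE GZE; rewrite -setUIl -setUUl.
have := rk_setU_diminish _ _ _ _ _ FGT TE ZE; rewrite (rkE _ FGT) (rkE _ (@subset_refl _ _)).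
move: modFG lcF lcG lcT; rewrite /modular_pair; lia.
Qed.

Lemma connectivity_cut_meet F G :
  OTE M -> connectivity_cut F -> connectivity_cut G -> F `&` G !=set0.
Proof.
move=> oteM CF CG.
have [H [fH CE]] := oteM _ connectivity_cut_modular (ex_intro _ F CF).
have gen K : connectivity_cut K -> flat M K /\ H `<=` K by rewrite CE.
(* The generator is itself a member of the cut. *)
have lcH : connectivity_cut H by rewrite CE; split.
have [[_ HF] [_ HG]] := (gen _ CF, gen _ CG).
apply/set0P/eqP => FG0; suff H0 : H = set0.
  by have [_] := lcH; rewrite H0 set0U rk0 add0n ltnn.
by rewrite -subset0 -FG0 => x Hx; split; [exact: HF|exact: HG].
Qed.

End ConnectivityCut.

Theorem theorem14 (U : Type) (M M' : matroid U) (X Y : set U)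
  (rkM : rk M (ground M) = 4)
  (oteM : OTE M)
  (extM : extension M M')
  (XE : X `<=` ground M') (YE : Y `<=` ground M')
  (flatXY : flat M' (X `&` Y))
  (lineX : line M (X `&` ground M)) (lineY : line M (Y `&` ground M))
  (disjXY : (X `&` ground M) `&` (Y `&` ground M) = set0)
  (coplXY : coplanar M (X `&` ground M) (Y `&` ground M))
  (ncl : ~ (ground M `<=` cl M' (X `|` Y))) :
  ~ modular_pair M' X Y.
Proof.
move=> modXY; have [TE rkE] := extM.
set T := ground M in rkM lineX lineY disjXY coplXY ncl TE rkE.
have := modular_pair_restrict _ _ _ _ _ _ XE YE
  (@subIsetl _ X T) (@subIsetl _ Y T) modXY.
set Z := X `&` Y in flatXY *; set A := X `&` T in lineX disjXY coplXY *.
set B := Y `&` T in lineY disjXY coplXY * => skewAB.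
have ZE : Z `<=` ground M' by case: flatXY.
have AT : A `<=` T by exact: subIsetr.
have BT : B `<=` T by exact: subIsetr.
have ABT : A `|` B `<=` T by rewrite subUset.
have [[fA rA] [fB rB]] := (lineX, lineY).
have rAB : rk M (A `|` B) = 3 := coplXY.
(* If [A] lay in [Z], it would lie in [Y] and hence in [A]&[B], which is empty, although [A] has
   rank 2. *)
have ltA : rk M' Z < rk M' (A `|` Z).
  apply: rk_lt_flatU flatXY (subset_trans AT TE) _ => AZ.
  suff A0 : A = set0 by move: rA; rewrite A0 rk0.
  rewrite -subset0 -disjXY => x Ax; split=> //; split; last exact: AT.
  by have [] := AZ _ Ax.
have ltB : rk M' Z < rk M' (B `|` Z).
  apply: rk_lt_flatU flatXY (subset_trans BT TE) _ => BZ.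
  suff B0 : B = set0 by move: rB; rewrite B0 rk0.
  rewrite -subset0 -disjXY => x Bx; split=> //; split; last exact: BT.
  by have [] := BZ _ Bx.
(* Passing from [A] to the plane [A]|[B] costs at most 3 - 2 = 1 in rank over [Z]. With [skewAB]
   this bounds r(B u Z) by r(Z) + 1; [dimB] does the same for [A]. *)
have dimA : rk M' (A `|` B `|` Z) + 2 <= rk M' (A `|` Z) + 3.
  have := rk_setU_diminish _ _ _ _ _ (@subsetUl _ A B) (subset_trans ABT TE) ZE.
  by rewrite (rkE _ AT) (rkE _ ABT) rA rAB.
have dimB : rk M' (A `|` B `|` Z) + 2 <= rk M' (B `|` Z) + 3.
  have := rk_setU_diminish _ _ _ _ _ (@subsetUr _ A B) (subset_trans ABT TE) ZE.
  by rewrite (rkE _ BT) (rkE _ ABT) rB rAB.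
(* By [skewAB], [ltA] and [ltB], r(A u B u Z) >= r(Z) + 2. A point [t] of [T] outside the closure of
   [X]|[Y] adds one more, so r(T u Z) >= r(Z) + 3, one short of r(Z) + r(T). *)
have lcT : rk M T + rk M' Z <= (rk M' (T `|` Z)).+1.
  have /existsNP[t /not_implyP[Tt ntXY]] := ncl.
  have XYE : X `|` Y `<=` ground M' by rewrite subUset.
  have tE : [set t] `<=` ground M' by move=> _ ->; exact: TE.
  have WXY : A `|` B `|` Z `<=` X `|` Y.
    by move=> x [[[Xx _]|[Yx _]]|[Xx _]]; [left|right|left].
  have := rk_setU_diminish _ _ _ _ _ WXY XYE tE.
  have : rk M' (A `|` B `|` Z `|` [set t]) <= rk M' (T `|` Z).
    apply: rk_mono; last by rewrite subUset.
    by move=> x [[/ABT|]|->]; [left|right|left].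
  have : rk M' (X `|` Y) <= rk M' (X `|` Y `|` [set t]).
    by apply: rk_mono => [x|]; [left|rewrite subUset].
  have : rk M' (X `|` Y `|` [set t]) <> rk M' (X `|` Y).
    by move=> e; apply: ntXY; split=> //; exact: TE.
  lia.
have CA : connectivity_cut _ M M' Z A by split=> //; lia.
have CB : connectivity_cut _ M M' Z B by split=> //; lia.
have [x] := connectivity_cut_meet _ _ _ _ extM ZE lcT _ _ oteM CA CB.
by rewrite disjXY.
Qed.
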